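(* Let $\mu,L>0$ and let $x\in\mathcal X^\circ$ with $\delta_\mu(x)>0$; put $\bar\alpha_\mu(x)=1/\delta_\mu(x)$. Then for every $\alpha\in(0,\bar\alpha_\mu(x))$ one has $x+\alpha d_\mu(x)\in\mathcal X^\circ$. Moreover, the optimal step size in the worst-case analytical sense is $$\alpha_\mu(x,L)=\begin{cases}\frac1{\delta_\mu(x)}\Big[1-\big(1+\frac{\delta_\mu(x)}{L+\mu}\frac{4-\nu}{\nu-2}\big)^{-\frac{\nu-2}{4-\nu}}\Big],&\nu\in(2,3)\cup(3,4),\\ \frac1{\delta_\mu(x)+L+\mu},&\nu=3,\\ \frac1{\delta_\mu(x)}\big[1-\exp\big(-\frac{\delta_\mu(x)}{L+\mu}\big)\big],&\nu=4,\end{cases}$$ that is, $\alpha_\mu(x,L)\in(0,\bar\alpha_\mu(x))$ and $\alpha_\mu(x,L)$ maximizes over $t\in(0,\bar\alpha_\mu(x))$ the guaranteed decrease $$\eta_\mu(x,t)=t\lambda_\mu(x)^2-(L+\mu)\,\omega_\nu(t\delta_\mu(x))\,t^2\lambda_\mu(x)^2 .$$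
   Context: $\mathcal C\subset\mathbb R^n$ is a nonempty open convex set containing no line; $A\in\mathbb R^{m\times n}$ has full row rank $m$, $b\in\mathbb R^m$; $\mathcal A=\{x:Ax=b\}$, $\mathcal X^\circ=\mathcal C\cap\mathcal A\ne\emptyset$. $f:\mathbb R^n\to(-\infty,+\infty]$ is proper, lower semicontinuous, finite and $C^1$ on $\mathcal C$. $M>0$, $\nu\in(2,4]$, and $h:\mathbb R^n\to(-\infty,+\infty]$ is a proper, closed (lower semicontinuous) convex function with effective domain $\operatorname{dom}h=\mathcal C$, $h\in C^3(\mathcal C)$, such that for all $x\in\mathcal C$, $u\in\mathbb R^n$, $v\in\mathbb R^n\setminus\{0\}$: $|\langle D^3h(x)[v]u,u\rangle|\le M\|u\|_x^2\|v\|_x^{\nu-2}\|v\|_2^{3-\nu}$, where $\|u\|_x=\sqrt{\langle H(x)u,u\rangle}$, $H(x)=\nabla^2h(x)$; if $\nu\in(3,4]$, moreover $h(x)\to\infty$ as $\|x\|\to\infty$. (Under these assumptions $H(x)$ is positive definite on $\mathcal C$.) The pair $(f,h)$ is $L$-smooth: with $D_h(y,x)=h(y)-h(x)-\langle\nabla h(x),y-x\rangle$, $f(y)-f(x)-\langle\nabla f(x),y-x\rangle\le L D_h(y,x)$ for all $x,y\in\mathcal C$. $F_\mu=f+\mu h$. For $x\in\mathcal X^\circ$: $d_\mu(x)=\operatorname{argmin}_v\{\langle\nabla F_\mu(x),v\rangle+\frac12\|v\|_x^2: Av=0\}$, $\lambda_\mu(x)=\|d_\mu(x)\|_x$, $\beta_\mu(x)=\|d_\mu(x)\|_2$,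 $\delta_\mu(x)=M\frac{\nu-2}{2}\lambda_\mu(x)^{\nu-2}\beta_\mu(x)^{3-\nu}$ (and $\delta_\mu(x)=0$ if $d_\mu(x)=0$). For $t\in(0,1)$: $$\omega_\nu(t)=\begin{cases}\frac{-t-\ln(1-t)}{t^2},&\nu=3,\\ \frac{(1-t)\ln(1-t)+t}{t^2},&\nu=4,\\ \big(\frac{\nu-2}{4-\nu}\big)\frac1t\Big[\frac{\nu-2}{2(3-\nu)t}\big((1-t)^{\frac{2(3-\nu)}{2-\nu}}-1\big)-1\Big],&\nu\in(2,3)\cup(3,4).\end{cases}$$ The quantity $\eta_\mu(x,t)$ is the worst-case lower bound on the decrease $F_\mu(x)-F_\mu(x+td_\mu(x))$, $t\in(0,1/\delta_\mu(x))$, used to define optimality of the step size. *)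

(* Defs.v *)
From HB Require Import structures.
From mathcomp Require Import all_boot all_order all_algebra.
From mathcomp Require Import all_classical all_reals all_analysis.

Set Implicit Arguments.
Unset Strict Implicit.
Unset Printing Implicit Defensive.

Import Order.TTheory GRing.Theory Num.Theory.
Import numFieldNormedType.Exports.

Local Open Scope classical_set_scope.
Local Open Scope ring_scope.

(* A function R^n -> (-oo, +oo] is a function to \bar R that is [proper_ext].  Its
   derivatives are only taken on an open set where it is finite, and are those
   of the real-valued function [fine \o g]. *)

Section euclidean.
Context {R : realType} {n : nat}.
Implicit Types (C : set 'cV[R]_n) (g : 'cV[R]_n -> R) (x y u v : 'cV[R]_n).

Definition dot u v : R := \sum_(i < n) u i 0 * v i 0.

(* The norm [`|v|] of the library is the sup norm. *)
Definition norm2 v : R := Num.sqrt (dot v v).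

Definition partial (i : 'I_n) g x : R := 'D_(delta_mx i 0) g x.

Definition grad g x : 'cV[R]_n := \col_i partial i g x.

Definition hess g x : 'M[R]_n := \matrix_(i, j) partial j (partial i g) x.

(* D^3 g(x)[v]: the derivative of the Hessian in the direction v *)
Definition D3 g x v : 'M[R]_n := \matrix_(i, j) 'D_v (fun y => hess g y i j) x.

Fixpoint class_C (k : nat) C g : Prop :=
  match k with
  | 0 => forall x, C x -> {for x, continuous g}
  | k'.+1 => (forall x, C x -> differentiable g x) /\
             (forall i, class_C k' C (partial i g))
  end.

Definition contains_line C : Prop :=
  exists x v : 'cV[R]_n, v != 0 /\ forall t : R, C (x + t *: v).

Definition local_norm g x u : R := Num.sqrt (dot (hess g x *m u) u).

Definition bregman g y x : R := g y - g x - dot (grad g x) (y - x).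

End euclidean.

Section extended.
Context {R : realType} {n : nat}.
Implicit Types (C : set 'cV[R]_n) (f g h : 'cV[R]_n -> \bar R).
Local Open Scope ereal_scope.

Definition dom g : set 'cV[R]_n := [set x | g x < +oo].

Definition proper_ext g : Prop := (forall x, g x != -oo) /\ dom g !=set0.

Definition convex_ext g : Prop :=
  forall (x y : 'cV[R]_n) (t : R), (0 < t < 1)%R ->
    g (t *: x + (1 - t) *: y)%R <= t%:E * g x + (1 - t)%:E * g y.

Definition coercive g : Prop :=
  forall K : R, exists r : R, forall x, (r < norm2 x)%R -> K%:E <= g x.

Definition gen_self_concordant (M nu : R) C h : Prop :=
  (forall x u v : 'cV[R]_n, C x -> v != 0 ->
    `|dot (D3 (fine \o h) x v *m u) u| <=
      M * local_norm (fine \o h) x u ^+ 2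
        * local_norm (fine \o h) x v `^ (nu - 2)
        * norm2 v `^ (3 - nu))%R.

Definition L_smooth (L : R) C f h : Prop :=
  (forall x y : 'cV[R]_n, C x -> C y ->
    bregman (fine \o f) y x <= L * bregman (fine \o h) y x)%R.

Definition potential f h (mu : R) : 'cV[R]_n -> \bar R :=
  fun x => f x + mu%:E * h x.

End extended.

Section step.
Context {R : realType} {m n : nat}.
Implicit Types (A : 'M[R]_(m, n)) (b : 'cV[R]_m) (f h : 'cV[R]_n -> \bar R).
Implicit Types (C : set 'cV[R]_n) (x v : 'cV[R]_n) (M nu mu L t : R).

Definition feasible C A b : set 'cV[R]_n := C `&` [set x | A *m x = b].

Definition direction_model f h mu x v : R :=
  dot (grad (fine \o potential f h mu) x) v +
  2^-1 * local_norm (fine \o h) x v ^+ 2.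

Definition is_direction A f h mu x : set 'cV[R]_n :=
  [set d | A *m d = 0 /\
     forall v : 'cV[R]_n, A *m v = 0 ->
       direction_model f h mu x d <= direction_model f h mu x v].

(* The default value 0 is only used when there is no minimizer. *)
Definition direction A f h mu x : 'cV[R]_n :=
  xget 0 (is_direction A f h mu x).

Definition lambda A f h mu x : R :=
  local_norm (fine \o h) x (direction A f h mu x).

Definition beta A f h mu x : R := norm2 (direction A f h mu x).

Definition delta M nu A f h mu x : R :=
  if direction A f h mu x == 0 then 0
  else M * ((nu - 2) / 2) * lambda A f h mu x `^ (nu - 2)
                          * beta A f h mu x `^ (3 - nu).

Definition omega nu t : R :=
  if nu == 3 then (- t - ln (1 - t)) / t ^+ 2
  else if nu == 4 then ((1 - t) * ln (1 - t) + t) / t ^+ 2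
  else (nu - 2) / (4 - nu) * (1 / t) *
       ((nu - 2) / (2 * (3 - nu) * t)
          * ((1 - t) `^ (2 * (3 - nu) / (2 - nu)) - 1) - 1).

Definition eta M nu L A f h mu x t : R :=
  t * lambda A f h mu x ^+ 2 -
  (L + mu) * omega nu (t * delta M nu A f h mu x) * t ^+ 2
    * lambda A f h mu x ^+ 2.

Definition opt_step M nu L A f h mu x : R :=
  let dlt := delta M nu A f h mu x in
  if nu == 3 then 1 / (dlt + L + mu)
  else if nu == 4 then 1 / dlt * (1 - expR (- (dlt / (L + mu))))
  else 1 / dlt *
       (1 - (1 + dlt / (L + mu) * ((4 - nu) / (nu - 2)))
              `^ (- ((nu - 2) / (4 - nu)))).

End step.

(* Main.v *)
(** Along the line [x + t d], the second derivative [p] of [h] satisfies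
    [|p'| <= K |p|^(nu/2)] with [K = M |d|_2^(3 - nu)], so [p^(-(nu-2)/2)] is
    Lipschitz, which yields [p(t) <= lambda^2 (1 - delta t)^(-2/(nu-2))] as long as
    [x + t d] stays in [C] and [delta t < 1].  Hence [h] remains bounded on the line
    up to any [t < 1/delta]; by lower semicontinuity the line cannot leave the
    domain of [h] before [1/delta].  Integrating twice bounds the Bregman distance
    [D_h(x + t d, x)] by [lambda^2 / delta^2 * G(delta t)] with
    [G(s) = s^2 omega_nu(s)], and [<grad F, d> = - lambda^2] turns this bound and
    [L]-smoothness into the decrease [eta].  Finally [eta] is a concave function
    of [t], because [G] is convex, and its derivative vanishes when
    [G'(delta t) = delta / (L + mu)], an equation solved by [opt_step]. *)
Require Import Defs.
From mathcomp Require Import all_boot all_order all_algebra.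
From mathcomp Require Import all_classical all_reals all_analysis.
From mathcomp Require Import ring lra.

Import Order.TTheory GRing.Theory Num.Theory.
Import numFieldNormedType.Exports.

Local Open Scope classical_set_scope.
Local Open Scope ring_scope.

(** * One-variable calculus and the Riccati-type differential inequality *)

Lemma ge0_is_derive_le {R : realType} {g dg : R -> R} {a b : R} : a <= b ->
  (forall t, a <= t <= b -> is_derive t 1 g (dg t)) ->
  (forall t, a <= t <= b -> 0 <= dg t) -> g a <= g b.
Proof.
move=> ab gdg dg0.
have [||c + /eqP] := @MVT_segment R g dg a b ab.
- by move=> t /[!in_itv]/= /andP[/ltW at_ /ltW tb]; apply: gdg; rewrite at_.
- apply: derivable_within_continuous => t /[!in_itv]/= tab.
  exact: (@ex_derive _ _ _ _ _ _ _ (gdg t tab)).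
rewrite in_itv/= => cab; rewrite -subr_ge0 => /eqP ->.
by rewrite mulr_ge0 ?dg0// subr_ge0.
Qed.

Lemma is_derive_powR_comp {R : realType} {g : R -> R} {t dg : R} (s : R) :
  0 < g t -> is_derive t 1 g dg ->
  is_derive t 1 (fun y => g y `^ s) (s * g t `^ (s - 1) * dg).
Proof.
move=> g0 dgt.
exact: (@is_derive1_comp R (fun y => y `^ s) g t _ _ (is_derive1_powR s g0) dgt).
Qed.

Lemma cvg_powR_add {R : realType} {c : R} (s : R) :
  0 < c -> (c + e) `^ s @[e --> 0^'+] --> c `^ s.
Proof.
move=> c0.
have d : is_derive (0 : R) 1 (fun e : R => (c + e) `^ s)
    (s * (c + 0) `^ (s - 1) * (0 + 1)).
  by apply: (@is_derive_powR_comp R (fun e => c + e)); rewrite ?addr0.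
have : {for (0 : R), continuous (fun e : R => (c + e) `^ s)}.
  apply: differentiable_continuous; apply/derivable1_diffP.
  exact: (@ex_derive _ _ _ _ _ _ _ d).
rewrite /prop_for /continuous_at addr0 => h; exact: cvg_at_right_filter.
Qed.

(* [p] may vanish or change sign, so [p `^ (- a)], whose derivative is bounded
   when [p] is positive, is replaced by [(p ^+ 2 + e) `^ (- (a / 2))] with
   [e] tending to [0]. *)
Lemma riccati_regularized {R : realType} {p dp : R -> R} {a K T e : R} :
  0 < a -> 0 <= K -> 0 <= T -> 0 < e ->
  (forall t, 0 <= t <= T -> is_derive t 1 p (dp t)) ->
  (forall t, 0 <= t <= T -> `|dp t| <= K * `|p t| `^ (a + 1)) ->
  (p 0 ^+ 2 + e) `^ (- (a / 2)) - a * K * T <= (p T ^+ 2 + e) `^ (- (a / 2)).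
Proof.
move=> a0 K0 T0 e0 pdp dpK.
have w0 t : 0 < p t ^+ 2 + e by rewrite ltr_wpDl// sqr_ge0.
(* The regularized power decreases at rate at most [a * K]; the linear term compensates for this, so
   [g] is nondecreasing. *)
pose g t := (p t ^+ 2 + e) `^ (- (a / 2)) + a * K * t.
suff : g 0 <= g T by rewrite /g mulr0 addr0 lerBlDr.
pose dg t := - (a / 2) * (p t ^+ 2 + e) `^ (- (a / 2) - 1) *
  (2 * p t * dp t) + a * K.
apply: (@ge0_is_derive_le R g dg _ _ T0) => t tT.
  have dpt := pdp t tT.
  rewrite /g /dg; apply: is_deriveD.
    apply: (@is_derive_powR_comp R (fun y => p y ^+ 2 + e)) => //.
    by apply: is_derive_eq; rewrite /GRing.scale/=; ring.
  by apply: is_derive_eq; rewrite /GRing.scale/=; ring.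
set w := p t ^+ 2 + e; have wt := w0 t; rewrite -/w in wt.
(* Replacing each [|p t|] by [w^(1/2)] bounds [|p dp|] by [K w^(a/2 + 1)], a power which the factor
   [w^(-a/2 - 1)] of [dg] cancels exactly. *)
have rt : `|p t| <= w `^ 2^-1.
  by rewrite powR12_sqrt ?(ltW wt)// -sqrtr_sqr ler_sqrt ?(ltW wt)// /w lerDl ltW.
have : `|p t * dp t| <= K * w `^ (a / 2 + 1).
  rewrite normrM (_ : a / 2 + 1 = 2^-1 + 2^-1 * (a + 1)); last by field.
  rewrite powRD ?(gt_eqF wt) ?implybT// powRrM mulrCA.
  apply: ler_pM => //; apply: (le_trans (dpK t tT)).
  rewrite ler_wpM2l// ge0_ler_powR ?nnegrE ?powR_ge0//.
  by rewrite addr_ge0// ltW.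
have wE : w `^ (a / 2 + 1) * w `^ (- (a / 2) - 1) = 1.
  rewrite -powRD ?(gt_eqF wt) ?implybT//.
  by rewrite (_ : _ + _ = 0) ?powRr0//; ring.
move=> /(ler_wpM2r (powR_ge0 w (- (a / 2) - 1))).
rewrite -mulrA wE mulr1 -(ger0_norm (powR_ge0 w _)) -normrM ler_norml.
move=> /andP[_ /(ler_wpM2l (ltW a0))].
rewrite /dg -/w => h.
rewrite (_ : _ * (2 * _ * _) = - (a * (p t * dp t * w `^ (- (a / 2) - 1)))).
  lra.
by field.
Qed.

(** Letting [e] tend to 0 in the regularized estimate gives [p(0)^(-a) - a K T <= p(T)^(-a)] when
    [p T] is positive, and this is solved for [p T]. *)
Lemma riccati_bound {R : realType} {p dp : R -> R} {a K T : R} :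
  0 < a -> 0 <= K -> 0 <= T -> 0 < p 0 -> a * K * p 0 `^ a * T < 1 ->
  (forall t, 0 <= t <= T -> is_derive t 1 p (dp t)) ->
  (forall t, 0 <= t <= T -> `|dp t| <= K * `|p t| `^ (a + 1)) ->
  p T <= p 0 * (1 - a * K * p 0 `^ a * T) `^ (- a^-1).
Proof.
move=> a0 K0 T0 p0 aT pdp dpK.
(* The right-hand side is nonnegative, so only [0 < p T] matters; the powers at both ends are then
   continuous at [e = 0]. *)
have [pT|pT] := leP (p T) 0.
  by rewrite (le_trans pT)// mulr_ge0 ?powR_ge0// ltW.
have sqE y : 0 < y -> (y ^+ 2) `^ (- (a / 2)) = (y `^ a)^-1.
  move=> y0; rewrite -powR_mulrn ?(ltW y0)// -powRrM -powRN.
  by congr (_ `^ _); field.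
have : (p 0 `^ a)^-1 - a * K * T <= (p T `^ a)^-1.
  rewrite -!sqE//.
  apply: (ler_cvg_to (a := 0^'+) (f := fun e => (p 0 ^+ 2 + e) `^ (- (a / 2)) - a * K * T)
    (g := fun e => (p T ^+ 2 + e) `^ (- (a / 2)))). 
  - exact: (cvgB (cvg_powR_add _ (exprn_gt0 2 p0)) (cvg_cst _)).
  - exact: (cvg_powR_add _ (exprn_gt0 2 pT)).
  - near=> e; apply: (riccati_regularized a0 K0 T0 _ pdp dpK); near: e.
    exact: nbhs_right_gt.
have p0a := powR_gt0 a p0; have pTa := powR_gt0 a pT.
set c := 1 - _.
have c0 : 0 < c by rewrite subr_gt0.
rewrite (_ : _ - _ = (p 0 `^ a)^-1 * c); last first.
  by rewrite /c; field; rewrite gt_eqF.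
move=> h.
have le : p T `^ a <= p 0 `^ a * c^-1.
  rewrite -lef_pV2 ?posrE ?mulr_gt0 ?invr_gt0//.
  by rewrite invfM invrK.
have K1 y : 0 < y -> (y `^ a) `^ a^-1 = y.
  by move=> y0; rewrite -powRrM divff ?gt_eqF// powRr1 ?ltW.
rewrite -(K1 _ pT) -(K1 _ p0).
have -> : c `^ (- a^-1) = (c^-1) `^ a^-1.
  by rewrite -[c^-1]powR_inv1 ?(ltW c0)// -powRrM mulN1r.
rewrite -powRM ?powR_ge0 ?invr_ge0 ?(ltW c0)//.
rewrite ge0_ler_powR ?nnegrE ?powR_ge0 ?invr_ge0 ?(ltW a0)//.
by rewrite mulr_ge0 ?powR_ge0 ?invr_ge0 ?(ltW c0).
Unshelve. all: by end_near.
Qed.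

(** * The function [s^2 omega_nu(s)], its derivatives and its convexity *)

(** The divisions by [s] in [omega] are cancelled, which makes the function differentiable at 0,
    where integration along the line starts. *)
Definition omega_sq {R : realType} (nu s : R) : R :=
  if nu == 3 then - s - ln (1 - s)
  else if nu == 4 then (1 - s) * ln (1 - s) + s
  else (nu - 2) / (4 - nu) *
       ((nu - 2) / (2 * (3 - nu)) * ((1 - s) `^ (2 * (3 - nu) / (2 - nu)) - 1) - s).

(* At [nu = 3] the general formula specializes to [(1 - s)^-1 - 1]. *)
Definition omega_sq' {R : realType} (nu s : R) : R :=
  if nu == 4 then - ln (1 - s)
  else (nu - 2) / (4 - nu) * ((1 - s) `^ ((4 - nu) / (2 - nu)) - 1).

Section omega_sq.
Context {R : realType}.
Implicit Types nu s c : R.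

Lemma omega_sqE nu s : s != 0 -> omega nu s * s ^+ 2 = omega_sq nu s.
Proof.
move=> s0; rewrite /omega /omega_sq; case: ifPn => [_|n3].
  by field.
case: ifPn => [_|n4]; first by field.
by field; rewrite s0 !subr_eq0 eq_sym n3 eq_sym n4.
Qed.

Lemma omega_sq0 nu : omega_sq nu 0 = 0.
Proof. by rewrite /omega_sq subr0 ln1 powR1; do 2?case: ifP => _; ring. Qed.

Lemma omega_sq'0 nu : omega_sq' nu 0 = 0.
Proof. by rewrite /omega_sq' subr0 ln1 powR1; case: ifP => _; ring. Qed.

Lemma is_derive_1B s : is_derive s 1 (fun y : R => 1 - y) (-1).
Proof. by apply: is_derive_eq; ring. Qed.

Lemma is_derive_ln1B s : s < 1 ->
  is_derive s 1 (fun y : R => ln (1 - y)) (- (1 - s)^-1).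
Proof.
rewrite -subr_gt0 => s1; rewrite -mulrN1.
exact: (@is_derive1_comp R (@ln R) (fun y => 1 - y) s _ _
  (is_derive1_ln s1) (is_derive_1B s)).
Qed.

Lemma is_derive_powR1B s e : s < 1 ->
  is_derive s 1 (fun y : R => (1 - y) `^ e) (- (e * (1 - s) `^ (e - 1))).
Proof.
rewrite -subr_gt0 => s1; rewrite -[- (e * _)]mulrN1.
exact: (@is_derive_powR_comp R (fun y => 1 - y) s _ e s1 (is_derive_1B s)).
Qed.

(** A single exponent covers every [nu]; at [nu = 4] it is [-1]. It is the exponent [- a^-1] of the
    Riccati bound for [a = (nu - 2) / 2], which makes [omega_sq] the double integral of that
    bound. *)
Lemma is_derive_omega_sq' nu s : nu != 2 -> s < 1 ->
  is_derive s 1 (omega_sq' nu) ((1 - s) `^ (2 / (2 - nu))).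
Proof.
move=> n2 s1; have s0 : 0 < 1 - s by rewrite subr_gt0.
rewrite /omega_sq'; case: eqVneq => [->|n4].
  have dl := is_derive_ln1B _ s1.
  apply: is_derive_eq; rewrite opprK (_ : 2 / (2 - 4) = -1 :> R); last by field.
  by rewrite powR_inv1// ltW.
have h2 : 2 - nu != 0 by rewrite subr_eq0 eq_sym.
have h4 : 4 - nu != 0 by rewrite subr_eq0 eq_sym.
have dl := is_derive_powR1B _ ((4 - nu) / (2 - nu)) s1.
apply: is_derive_eq; rewrite /GRing.scale/=.
rewrite (_ : (4 - nu) / (2 - nu) - 1 = 2 / (2 - nu)); last by field.
by field; rewrite h2 h4.
Qed.

Lemma is_derive_omega_sq nu s : nu != 2 -> s < 1 ->
  is_derive s 1 (omega_sq nu) (omega_sq' nu s).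
Proof.
move=> n2 s1; have s0 : 0 < 1 - s by rewrite subr_gt0.
have dl := is_derive_ln1B _ s1.
rewrite /omega_sq /omega_sq'; case: (eqVneq nu 3) => [n3|n3].
  rewrite n3 eqr_nat/= (_ : (4 - 3) / (2 - 3) = -1 :> R); last by field.
  rewrite powR_inv1 ?(ltW s0)//; apply: is_derive_eq.
  by field; rewrite gt_eqF.
case: eqVneq => [_|n4].
  have dB := is_derive_1B s.
  by apply: is_derive_eq; rewrite /GRing.scale/=; field; rewrite gt_eqF.
have h2 : 2 - nu != 0 by rewrite subr_eq0 eq_sym.
have h3 : 3 - nu != 0 by rewrite subr_eq0 eq_sym.
have h4 : 4 - nu != 0 by rewrite subr_eq0 eq_sym.
have dp := is_derive_powR1B _ (2 * (3 - nu) / (2 - nu)) s1.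
apply: is_derive_eq; rewrite /GRing.scale/=.
rewrite (_ : 2 * (3 - nu) / (2 - nu) - 1 = (4 - nu) / (2 - nu)); last by field.
by field; rewrite h2 h3 h4.
Qed.

Lemma omega_sq'_ndecr nu s t : nu != 2 -> s <= t -> t < 1 ->
  omega_sq' nu s <= omega_sq' nu t.
Proof.
move=> n2 st t1.
apply: (ge0_is_derive_le (dg := fun y => (1 - y) `^ (2 / (2 - nu))) st) => y /andP[_ yt].
  exact: is_derive_omega_sq' (le_lt_trans yt t1).
exact: powR_ge0.
Qed.

(** Since [omega_sq' nu] is nondecreasing, subtracting the linear function of slope [omega_sq' nu s]
    leaves a function that is nonincreasing before [s] and nondecreasing after it. *)
Lemma omega_sq_convex nu s t : nu != 2 -> s < 1 -> t < 1 ->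
  omega_sq nu s + omega_sq' nu s * (t - s) <= omega_sq nu t.
Proof.
move=> n2 s1 t1; set c := omega_sq' nu s.
have d (y : R) : y < 1 ->
    is_derive y 1 (fun r => omega_sq nu r - c * r) (omega_sq' nu y - c).
  move=> y1; have dy := is_derive_omega_sq _ _ n2 y1.
  by apply: is_derive_eq; rewrite /GRing.scale/=; ring.
suff : omega_sq nu s - c * s <= omega_sq nu t - c * t by lra.
have [st|/ltW ts] := leP s t.
  apply: (ge0_is_derive_le (g := fun y => omega_sq nu y - c * y)
    (dg := fun y => omega_sq' nu y - c) st) => y /andP[sy yt].
    by apply: d; exact: le_lt_trans yt t1.
  by rewrite subr_ge0 omega_sq'_ndecr// (le_lt_trans yt).
rewrite -lerN2.
apply: (ge0_is_derive_le (g := fun y => - (omega_sq nu y - c * y))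
  (dg := fun y => - (omega_sq' nu y - c)) ts) => y /andP[ty ys].
  by apply: is_deriveN; apply: d; exact: le_lt_trans ys s1.
by rewrite oppr_ge0 subr_le0 omega_sq'_ndecr.
Qed.

(** This is the optimal step in the scaled variable [s = delta t], with [c = delta / (L + mu)]. At
    [nu = 3] it reduces to [c / (1 + c)]. *)
Definition omega_sq'_inv nu c : R :=
  if nu == 4 then 1 - expR (- c)
  else 1 - (1 + c * ((4 - nu) / (nu - 2))) `^ (- ((nu - 2) / (4 - nu))).

Lemma omega_sq'_invP nu c : 2 < nu -> nu <= 4 -> 0 < c ->
  0 < omega_sq'_inv nu c < 1 /\ omega_sq' nu (omega_sq'_inv nu c) = c.
Proof.
move=> n2 n4 c0; rewrite /omega_sq'_inv /omega_sq'; case: eqVneq => [_|n4'].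
  rewrite subKr expRK opprK; split => //.
  by rewrite subr_gt0 expR_lt1 oppr_lt0 c0 gtrBl expR_gt0.
have lt4 : 0 < 4 - nu by rewrite subr_gt0 lt_neqAle n4'.
have gt2 : 0 < nu - 2 by rewrite subr_gt0.
set w := 1 + c * _.
have w1 : 1 < w by rewrite ltrDl mulr_gt0// divr_gt0.
have w0 : 0 < w := lt_trans ltr01 w1.
split.
  rewrite gtrBl powR_gt0// andbT subr_gt0 powRN invf_lt1 ?powR_gt0//.
  have e0 : 0 < (nu - 2) / (4 - nu) by rewrite divr_gt0.
  have := gt0_ltr_powR e0 _ _ w1.
  by rewrite powR1 !nnegrE (ltW w0) ler01; apply.
rewrite subKr -powRrM (_ : - _ * _ = 1); last first.
  have h2 : 2 - nu != 0 by rewrite subr_eq0 lt_eqF.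
  by field; rewrite h2 (gt_eqF lt4).
by rewrite powRr1 ?(ltW w0)// /w; field; rewrite (gt_eqF gt2) (gt_eqF lt4).
Qed.

(** Both integrations are monotonicity arguments: the bound minus the function has a nonnegative
    derivative, first for [dphi], then for [phi]. The coefficient [l] will be the squared local norm
    of the direction. *)
Lemma omega_sq_bound nu (l dlt T : R) (phi dphi p : R -> R) :
  nu != 2 -> 0 < dlt -> 0 <= T -> dlt * T < 1 ->
  (forall t, 0 <= t <= T -> is_derive t 1 phi (dphi t)) ->
  (forall t, 0 <= t <= T -> is_derive t 1 dphi (p t)) ->
  (forall t, 0 <= t <= T -> p t <= l * (1 - dlt * t) `^ (2 / (2 - nu))) ->
  phi T <= phi 0 + T * dphi 0 + l / dlt ^+ 2 * omega_sq nu (dlt * T).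
Proof.
move=> n2 d0 T0 dT phid dphid pb.
have dt1 (t : R) : t <= T -> dlt * t < 1.
  by move=> tT; rewrite (le_lt_trans _ dT)// ler_pM2l.
have dlin (t : R) : is_derive t 1 (fun y : R => dlt * y) dlt.
  by apply: is_derive_eq; rewrite /GRing.scale/=; ring.
have dG (t : R) : t <= T ->
    is_derive t 1 (fun y => omega_sq nu (dlt * y)) (omega_sq' nu (dlt * t) * dlt).
  move=> /dt1 tT.
  exact: (is_derive1_comp (is_derive_omega_sq _ _ n2 tT) (dlin t)).
have dG' (t : R) : t <= T ->
    is_derive t 1 (fun y => omega_sq' nu (dlt * y)) ((1 - dlt * t) `^ (2 / (2 - nu)) * dlt).
  move=> /dt1 tT.
  exact: (is_derive1_comp (is_derive_omega_sq' _ _ n2 tT) (dlin t)).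
have h1 (t : R) : 0 <= t <= T -> dphi t <= dphi 0 + l / dlt * omega_sq' nu (dlt * t).
  move=> /andP[t0 tT].
  have := @ge0_is_derive_le R (fun y => l / dlt * omega_sq' nu (dlt * y) - dphi y)
    (fun y => l * (1 - dlt * y) `^ (2 / (2 - nu)) - p y) 0 t t0.
  rewrite mulr0 omega_sq'0 => H.
  suff : l / dlt * 0 - dphi 0 <= l / dlt * omega_sq' nu (dlt * t) - dphi t by lra.
  apply: H => y /andP[y0 yt]; have yT := le_trans yt tT.
    have d1 := dG' y yT; have d2 := dphid y; rewrite y0 yT in d2.
    have {}d2 := d2 isT.
    by apply: is_derive_eq; rewrite /GRing.scale/=; field; rewrite gt_eqF.
  by rewrite subr_ge0 pb// y0.
have := @ge0_is_derive_le R
    (fun y => l / dlt ^+ 2 * omega_sq nu (dlt * y) + y * dphi 0 - phi y)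
    (fun y => l / dlt * omega_sq' nu (dlt * y) + dphi 0 - dphi y) 0 T T0.
rewrite mulr0 omega_sq0 => H.
suff : l / dlt ^+ 2 * 0 + 0 * dphi 0 - phi 0 <=
    l / dlt ^+ 2 * omega_sq nu (dlt * T) + T * dphi 0 - phi T by lra.
apply: H => y /andP[y0 yT].
  have d1 := dG y yT; have d2 := phid y; rewrite y0 yT in d2.
  have {}d2 := d2 isT.
  by apply: is_derive_eq; rewrite /GRing.scale/=; field; rewrite gt_eqF.
by have := h1 y; rewrite y0 yT => /(_ isT); lra.
Qed.

End omega_sq.

(** * Derivatives of a function along a line, up to the third *)

Section line.
Context {R : realType} {n : nat}.
Implicit Types (g : 'cV[R]_n -> R) (x y u v d : 'cV[R]_n).

Lemma dotDl u v d : dot (u + v) d = dot u d + dot v d.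
Proof. by rewrite -big_split/=; apply: eq_bigr => i _; rewrite mxE mulrDl. Qed.

Lemma dotZl (k : R) u v : dot (k *: u) v = k * dot u v.
Proof. by rewrite /dot mulr_sumr; apply: eq_bigr => i _; rewrite mxE mulrA. Qed.

Lemma dotZr (k : R) u v : dot u (k *: v) = k * dot u v.
Proof. by rewrite /dot mulr_sumr; apply: eq_bigr => i _; rewrite mxE mulrCA. Qed.

Lemma derive_dot g y v : differentiable g y -> 'D_v g y = dot (grad g y) v.
Proof.
move=> dg; have vE : v = \sum_i v i 0 *: delta_mx i 0.
  by rewrite {1}(matrix_sum_delta v); apply: eq_bigr => i _; rewrite big_ord1.
rewrite deriveE// {1}vE linear_sum; apply: eq_bigr => i _.
by rewrite linearZ/= mxE /partial deriveE// mulrC.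
Qed.

Lemma is_derive_line g x v (t : R) : derivable g (x + t *: v) v ->
  is_derive t 1 (fun s : R => g (x + s *: v)) ('D_v g (x + t *: v)).
Proof.
move=> dg.
(* The one-variable difference quotient is the directional one of [g] at [x + t *: v]. *)
have E : (fun h : R => h^-1 *: (g (x + (h *: 1 + t) *: v) - g (x + t *: v))) =
    (fun h : R => h^-1 *: (g (h *: v + (x + t *: v)) - g (x + t *: v))).
  apply/funext => h; congr (_ *: (g _ - _)).
  by rewrite scalerDl -[h *: 1]/(h * 1) mulr1 addrCA.
split; first by rewrite /derivable/= E.
by rewrite /derive/= E.
Qed.

Lemma is_derive_dot (F : R -> 'cV[R]_n) (dF v : 'cV[R]_n) (t : R) :
  (forall i, is_derive t 1 (fun s => F s i 0) (dF i 0)) ->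
  is_derive t 1 (fun s => dot (F s) v) (dot dF v).
Proof.
move=> h; have -> : (fun s => dot (F s) v) = \sum_(i < n) (fun s => F s i 0 * v i 0).
  by apply/funext => s; rewrite fct_sumE.
apply: is_derive_sum => i; have hi := h i.
by apply: is_derive_eq; rewrite /GRing.scale/=; ring.
Qed.

Lemma is_derive_line1 g x v (t : R) : differentiable g (x + t *: v) ->
  is_derive t 1 (fun s : R => g (x + s *: v)) (dot (grad g (x + t *: v)) v).
Proof.
by move=> dg; rewrite -derive_dot//; apply: is_derive_line; exact: diff_derivable.
Qed.

Lemma is_derive_line2 g x v (t : R) :
  (forall i, differentiable (partial i g) (x + t *: v)) ->
  is_derive t 1 (fun s : R => dot (grad g (x + s *: v)) v)
    (dot (hess g (x + t *: v) *m v) v).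
Proof.
move=> dg; apply: is_derive_dot => i.
have -> : (fun s : R => grad g (x + s *: v) i 0) =
    (fun s : R => partial i g (x + s *: v)).
  by apply/funext => s; rewrite mxE.
have -> : (hess g (x + t *: v) *m v) i 0 = dot (grad (partial i g) (x + t *: v)) v.
  by rewrite mxE; apply: eq_bigr => j _; rewrite !mxE.
exact: is_derive_line1.
Qed.

Lemma is_derive_line3 g x v (t : R) :
  (forall i j, differentiable (partial j (partial i g)) (x + t *: v)) ->
  is_derive t 1 (fun s : R => dot (hess g (x + s *: v) *m v) v)
    (dot (D3 g (x + t *: v) v *m v) v).
Proof.
move=> dg; apply: is_derive_dot => i.
have -> : (fun s : R => (hess g (x + s *: v) *m v) i 0) =
    (fun s : R => dot (row i (hess g (x + s *: v)))^T v).
  by apply/funext => s; rewrite mxE; apply: eq_bigr => j _; rewrite !mxE.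
have -> : (D3 g (x + t *: v) v *m v) i 0 = dot (row i (D3 g (x + t *: v) v))^T v.
  by rewrite mxE; apply: eq_bigr => j _; rewrite !mxE.
apply: is_derive_dot => j; rewrite !mxE.
have -> : (fun s : R => (row i (hess g (x + s *: v)))^T j 0) =
    (fun s : R => hess g (x + s *: v) i j).
  by apply/funext => s; rewrite !mxE.
apply: is_derive_line.
have -> : (fun y => hess g y i j) = partial j (partial i g).
  by apply/funext => y; rewrite mxE.
exact: diff_derivable.
Qed.

End line.

(** * Self-concordance along a line: growth of [h] and permanence in the domain *)

(** The infimum of the counterexamples satisfies [P] by the inductive step; openness then frees a
    neighbourhood of it from counterexamples, a contradiction. *)
Lemma real_induction {R : realType} (P : set R) (a : R) : open P ->
  (forall T, 0 <= T <= a -> (forall s, 0 <= s < T -> P s) -> P T) ->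
  forall t, 0 <= t <= a -> P t.
Proof.
move=> oP step t ta; apply: contrapT => nPt.
pose S := [set s | 0 <= s <= a /\ ~ P s].
have St : S t by [].
have lbS : lbound S 0 by move=> s [/andP[]].
have infS : has_inf S by split; [exists t|exists 0].
have T0 : 0 <= inf S by apply: lb_le_inf => //; exists t.
have TS s : S s -> inf S <= s by move=> Ss; apply: ge_inf => //; exists 0.
have PT : P (inf S).
  apply: step => [|s /andP[s0 sT]].
    by rewrite T0 (le_trans (TS _ St))//; case/andP: ta.
  apply: contrapT => nPs.
  suff /TS : S s by rewrite leNgt sT.
  split=> //; rewrite s0 ltW// (lt_le_trans sT)// (le_trans (TS _ St))//.
  by case/andP: ta.
have /nbhs_ballP[e /= e0 be] : nbhs (inf S) P by exact: open_nbhs_nbhs.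
have [s Ss sT] := inf_adherent e0 infS.
apply: (proj2 Ss); apply: be; rewrite /ball/= ler0_norm ?subr_le0 ?TS//.
by rewrite opprB ltrBlDl.
Qed.

Section gsc_line.
Context {R : realType} {n : nat}.
Variables (C : set 'cV[R]_n) (h : 'cV[R]_n -> \bar R) (M nu : R) (x d : 'cV[R]_n).
Variables l dlt : R.
Hypotheses (M_ge0 : 0 <= M) (nu_gt2 : 2 < nu).
Hypotheses (h_C3 : class_C 3 C (fine \o h)) (h_gsc : gen_self_concordant M nu C h).
Hypothesis d_neq0 : d != 0.

Hypotheses (lE : l = local_norm (fine \o h) x d)
  (dltE : dlt = M * ((nu - 2) / 2) * l `^ (nu - 2) * norm2 d `^ (3 - nu)).
Hypotheses (l_gt0 : 0 < l) (dlt_gt0 : 0 < dlt).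

Let p (t : R) := dot (hess (fine \o h) (x + t *: d) *m d) d.

Lemma sqr_local_normE : l ^+ 2 = p 0.
Proof.
move: l_gt0; rewrite lE /local_norm /p scale0r addr0 sqrtr_gt0 => /ltW.
exact: sqr_sqrtr.
Qed.

Lemma gsc_line_bound (T : R) : 0 <= T -> dlt * T < 1 ->
  (forall t, 0 <= t <= T -> C (x + t *: d)) ->
  fine (h (x + T *: d)) <= fine (h x) + T * dot (grad (fine \o h) x) d
    + l ^+ 2 / dlt ^+ 2 * omega_sq nu (dlt * T).
Proof.
move=> T0 dT CT.
have [h1 h2 h3] : [/\ forall y, C y -> differentiable (fine \o h) y,
    forall i y, C y -> differentiable (partial i (fine \o h)) y &
    forall i j y, C y -> differentiable (partial j (partial i (fine \o h))) y].
  split=> [y Cy|i y Cy|i j y Cy]; case: h_C3.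
  - by move=> /(_ y Cy).
  - by move=> _ /(_ i) [/(_ y Cy)].
  - by move=> _ /(_ i) [_ /(_ j) [/(_ y Cy)]].
(* With both directions equal to [d], the local norms contribute [p^(nu/2)], and [nu / 2 = a + 1];
   [K] collects the factors constant along the line. *)
pose a := (nu - 2) / 2; pose K := M * norm2 d `^ (3 - nu).
have a0 : 0 < a by rewrite divr_gt0// subr_gt0.
have K0 : 0 <= K by rewrite mulr_ge0// powR_ge0.
have p0 : 0 < p 0 by rewrite -sqr_local_normE exprn_gt0.
have powE y : 0 < y -> Num.sqrt y `^ (nu - 2) = y `^ a.
  move=> y0; rewrite -powR12_sqrt ?(ltW y0)// -powRrM.
  by congr (_ `^ _); rewrite mulrC.
(* The blow-up rate in the Riccati bound is exactly [delta]. *)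
have aKE : a * K * p 0 `^ a = dlt.
  have -> : p 0 `^ a = l `^ (nu - 2).
    by rewrite -(powE _ p0) -sqr_local_normE sqrtr_sqr (gtr0_norm l_gt0).
  by rewrite dltE /K -/a; ring.
have dt1 (t : R) : t <= T -> dlt * t < 1.
  by move=> tT; rewrite (le_lt_trans _ dT)// ler_pM2l.
have expE : - a^-1 = 2 / (2 - nu).
  have nu2 : 2 - nu != 0 by rewrite subr_eq0 lt_eqF.
  have nu2' : nu - 2 != 0 by rewrite subr_eq0 gt_eqF.
  by rewrite /a; field; rewrite nu2 nu2'.
have pb (t : R) : 0 <= t <= T -> p t <= l ^+ 2 * (1 - dlt * t) `^ (2 / (2 - nu)).
  move=> /andP[t0 tT].
  have CT' (s : R) : 0 <= s <= t -> C (x + s *: d).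
    by move=> /andP[s0 st]; apply: CT; rewrite s0 (le_trans st).
  rewrite sqr_local_normE -expE -aKE.
  apply: (@riccati_bound _ p (fun s => dot (D3 (fine \o h) (x + s *: d) d *m d) d)) => //.
  - by rewrite aKE dt1.
  - by move=> s st; apply: is_derive_line3 => i j; apply: h3; exact: CT'.
  - move=> s st; apply: (le_trans (h_gsc _ d d (CT' s st) d_neq0)).
    rewrite /local_norm -/(p s).
    (* The square root of a nonpositive number is 0, so in that case self-concordance bounds the
       third derivative by 0. *)
    have [ps|ps] := leP (p s) 0.
      by rewrite ler0_sqrtr// expr0n/= mulr0 !mul0r mulr_ge0// powR_ge0.
    rewrite powE// sqr_sqrtr ?(ltW ps)// (gtr0_norm ps) powRD ?(gt_eqF ps) ?implybT//.
    by rewrite powRr1 ?(ltW ps)// le_eqVlt; apply/orP; left; apply/eqP; rewrite /K; ring.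
have n2 : nu != 2 by rewrite gt_eqF.
have := @omega_sq_bound _ nu (l ^+ 2) dlt T (fun s => fine (h (x + s *: d)))
  (fun s => dot (grad (fine \o h) (x + s *: d)) d) p n2 dlt_gt0 T0 dT.
rewrite scale0r addr0; apply => // t tT.
- by apply: (is_derive_line1 (fine \o h)); apply: h1; exact: CT.
- by apply: is_derive_line2 => i; apply: h2; exact: CT.
Qed.

Lemma gsc_line_dom (t : R) : open C -> lower_semicontinuous h -> dom h = C ->
  (forall y, h y != -oo%E) -> C x -> 0 <= t -> dlt * t < 1 -> C (x + t *: d).
Proof.
move=> oC lsc domC hNy Cx t0 dt.
have cline : continuous (fun s : R => x + s *: d).
  move=> s; apply: cvgD; first exact: cvg_cst.
  by apply: cvgZr_tmp; exact: cvg_id.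
suff : forall s, 0 <= s <= t -> [set s : R | C (x + s *: d)] s.
  by apply; rewrite t0 lexx.
(* Openness of [C] gives the open condition; what remains is to pass from [[0, T)] to the endpoint
   [T]. *)
apply: real_induction => [|T /andP[T0 Tt] CT].
  exact: (open_comp (fun s _ => cline s)).
have dT : dlt * T < 1 by rewrite (le_lt_trans _ dt)// ler_pM2l.
pose B (s : R) := fine (h x) + s * dot (grad (fine \o h) x) d
    + l ^+ 2 / dlt ^+ 2 * omega_sq nu (dlt * s).
have hB (s : R) : 0 <= s < T -> fine (h (x + s *: d)) <= B s.
  move=> /andP[s0 sT]; apply: gsc_line_bound => //.
    by rewrite (le_lt_trans _ dT)// ler_pM2l// ltW.
  by move=> r /andP[r0 rs]; apply: CT; rewrite r0 (le_lt_trans rs).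
have [<-|TN0] := eqVneq 0 T; first by rewrite /= scale0r addr0.
have {TN0}T0 : 0 < T by rewrite lt_neqAle TN0.
rewrite /= -domC /dom/= ltNge leye_eq; apply/negP => /eqP hT.
(* As [dlt * T < 1], the upper bound [B] does not blow up at [T]. *)
have cB : B s @[s --> T] --> B T.
  apply: differentiable_continuous; apply/derivable1_diffP.
  have n2 : nu != 2 by rewrite gt_eqF.
  have dlin : is_derive T 1 (fun y : R => dlt * y) dlt.
    by apply: is_derive_eq; rewrite /GRing.scale/=; ring.
  have dG : is_derive T 1 (fun y => omega_sq nu (dlt * y)) (omega_sq' nu (dlt * T) * dlt).
    exact: (is_derive1_comp (is_derive_omega_sq _ _ n2 dT) dlin).
  have dB : is_derive T 1 B (dot (grad (fine \o h) x) d +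
      l ^+ 2 / dlt ^+ 2 * (omega_sq' nu (dlt * T) * dlt)).
    by rewrite /B; apply: is_derive_eq; rewrite /GRing.scale/=; ring.
  exact: (@ex_derive _ _ _ _ _ _ _ dB).
(* If [h] were infinite at the endpoint, semicontinuity would keep it above [B T + 1] nearby,
   whereas just left of [T] it is at most [B s < B T + 1]. *)
have [V VT hV] : exists2 V : set 'cV[R]_n, nbhs (x + T *: d) V &
    forall y, V y -> ((B T + 1)%:E < h y)%E.
  by apply: lsc; rewrite hT ltry.
have nB : \forall s \near T^'-, B s < B T + 1.
  by apply: (cvgr_lt (B T)); [exact: cvg_at_left_filter|rewrite ltrDl].
have nV : \forall s \near T^'-, V (x + s *: d).
  exact: (cvg_at_left_filter (cline T) VT).
have : \forall s \near T^'-, 0 <= s < T /\ B s < B T + 1 /\ V (x + s *: d).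
  near=> s; split; last by split; near: s.
  by apply/andP; split; near: s; [exact: nbhs_left_ge|exact: nbhs_left_lt].
move=> /filter_ex[s [sT [Bs /hV]]].
have : C (x + s *: d) by exact: CT.
rewrite -domC /dom/= => hy.
have hf : h (x + s *: d) \is a fin_num by rewrite fin_numE hNy/= lt_eqF.
rewrite -(fineK hf) lte_fin ltNge => /negP; apply.
by rewrite (le_trans (hB s sT))// ltW.
Unshelve. all: by end_near.
Qed.

End gsc_line.

(** * The potential, the search direction and closed forms of the step and of [eta] *)

Lemma potentialE {R : realType} {n : nat} (f h : 'cV[R]_n -> \bar R) (mu : R)
    (y : 'cV[R]_n) : f y \is a fin_num -> h y \is a fin_num ->
  potential f h mu y = (fine (f y) + mu * fine (h y))%:E.
Proof.
by move=> ff fh; rewrite /potential EFinD EFinM (fineK ff) (fineK fh).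
Qed.

Lemma grad_potential {R : realType} {n : nat} {C : set 'cV[R]_n}
    {f h : 'cV[R]_n -> \bar R} (mu : R) {x : 'cV[R]_n} :
  open C -> C x ->
  (forall y, C y -> f y \is a fin_num) -> (forall y, C y -> h y \is a fin_num) ->
  differentiable (fine \o f) x -> differentiable (fine \o h) x ->
  grad (fine \o potential f h mu) x = grad (fine \o f) x + mu *: grad (fine \o h) x.
Proof.
move=> oC Cx ff fh df dh; apply/colP => i; rewrite !mxE /partial.
have If : is_derive x (delta_mx i 0) (fine \o f) ('D_(delta_mx i 0) (fine \o f) x).
  by split=> //; exact: diff_derivable.
have Ih : is_derive x (delta_mx i 0) (fine \o h) ('D_(delta_mx i 0) (fine \o h) x).
  by split=> //; exact: diff_derivable.
have Ifh := is_deriveD If (is_deriveZ mu Ih).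
apply: (@derive_val _ _ _ _ _ _ _ (near_eq_is_derive _ Ifh)).
(* The real formula for the potential is available on [C]; openness makes it valid near [x], which
   suffices for derivatives. *)
have : \forall y \near x, C y by exact: open_nbhs_nbhs.
by apply: filterS => y Cy; rewrite /= (potentialE _ _ _ _ (ff y Cy) (fh y Cy)).
Qed.

Lemma local_normZ {R : realType} {n : nat} (g : 'cV[R]_n -> R) (x v : 'cV[R]_n) (k : R) :
  local_norm g x (k *: v) ^+ 2 = k ^+ 2 * local_norm g x v ^+ 2.
Proof.
rewrite /local_norm -scalemxAr dotZl dotZr mulrA -expr2 sqrtrM ?sqr_ge0//.
by rewrite exprMn sqr_sqrtr ?sqr_ge0.
Qed.

(* The model along the line spanned by [d] is minimal at [d] itself. *)
Lemma direction_descent {R : realType} {m n : nat} {A : 'M[R]_(m, n)}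
    {f h : 'cV[R]_n -> \bar R} {mu : R} {x d : 'cV[R]_n} :
  is_direction A f h mu x d -> 0 < local_norm (fine \o h) x d ->
  dot (grad (fine \o potential f h mu) x) d = - local_norm (fine \o h) x d ^+ 2.
Proof.
move=> [Ad mind] l0; set g := dot _ d; set q := _ ^+ 2.
have q0 : 0 < q by rewrite exprn_gt0.
(* The factor [- g / q] minimizes [k g + k^2 q / 2]; the model at [d] exceeds this minimum by
   [(g + q)^2 / (2 q)], so minimality of [d] forces [g = - q]. *)
have := mind ((- g / q) *: d); rewrite -scalemxAr Ad scaler0 => /(_ erefl).
rewrite /direction_model local_normZ dotZr -/g -/q => H.
have : (g + q) ^+ 2 <= 0.
  have -> : (g + q) ^+ 2 =
      2 * q * (g + 2^-1 * q - (- g / q * g + 2^-1 * ((- g / q) ^+ 2 * q))).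
    by field; rewrite gt_eqF.
  by rewrite pmulr_rle0 ?mulr_gt0// subr_le0.
move=> h2; have /eqP : (g + q) ^+ 2 == 0 by rewrite eq_le h2 sqr_ge0.
by move=> /eqP; rewrite sqrf_eq0 addr_eq0 => /eqP.
Qed.

Lemma bregman_line {R : realType} {n : nat} (g : 'cV[R]_n -> R) (x d : 'cV[R]_n) (t : R) :
  bregman g (x + t *: d) x = g (x + t *: d) - g x - t * dot (grad g x) d.
Proof.
by rewrite /bregman (_ : x + t *: d - x = t *: d) ?dotZr// addrC addKr.
Qed.

(** The case [nu = 3] is the general formula with exponent [-1], so all cases are one inverse of
    [omega_sq'] in the scaled variable. *)
Lemma opt_stepE {R : realType} {m n : nat} (M nu L mu : R) (A : 'M[R]_(m, n))
    (f h : 'cV[R]_n -> \bar R) (x : 'cV[R]_n) :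
  0 < delta M nu A f h mu x -> 0 < L + mu ->
  opt_step M nu L A f h mu x =
    (delta M nu A f h mu x)^-1 *
    omega_sq'_inv nu (delta M nu A f h mu x / (L + mu)).
Proof.
rewrite /opt_step /omega_sq'_inv; set dlt := delta _ _ _ _ _ _ _ => d0 Lm0.
rewrite !div1r; case: eqVneq => [->|_]; last by case: ifP.
have e1 : (4 - 3) / (3 - 2) = 1 :> R by field.
have e2 : - ((3 - 2) / (4 - 3)) = -1 :> R by field.
have c0 : 0 < dlt / (L + mu) by rewrite divr_gt0.
rewrite eqr_nat/= e1 e2 mulr1 powR_inv1 ?addr_ge0 ?(ltW c0)//.
have s0 : 0 < L + mu + dlt by rewrite addr_gt0.
by field; rewrite !gt_eqF.
Qed.

(** Absorbing [t^2] into [omega_sq] displays [eta] as linear minus convex in [t]. *)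
Lemma etaE {R : realType} {m n : nat} (M nu L mu : R) (A : 'M[R]_(m, n))
    (f h : 'cV[R]_n -> \bar R) (x : 'cV[R]_n) (t : R) :
  delta M nu A f h mu x != 0 -> t != 0 ->
  eta M nu L A f h mu x t = t * lambda A f h mu x ^+ 2 -
    (L + mu) * (lambda A f h mu x ^+ 2 / delta M nu A f h mu x ^+ 2 *
      omega_sq nu (delta M nu A f h mu x * t)).
Proof.
move=> d0 t0; rewrite /eta -omega_sqE ?mulf_neq0// [in RHS]mulrC.
set dlt := delta _ _ _ _ _ _ _ in d0 *; rewrite (mulrC t dlt).
by field.
Qed.

(** * Feasibility, guaranteed decrease and optimality of the step *)

Theorem proposition3p5 (R : realType) (m n : nat)
  (C : set 'cV[R]_n) (A : 'M[R]_(m, n)) (b : 'cV[R]_m)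
  (f h : 'cV[R]_n -> \bar R) (M nu mu L : R) (x : 'cV[R]_n)
  (C_nonempty : C !=set0) (C_open : open C) (C_convex : convex_set C)
  (C_no_line : ~ contains_line C)
  (A_full_rank : \rank A = m)
  (X_nonempty : feasible C A b !=set0)
  (f_proper : proper_ext f) (f_lsc : lower_semicontinuous f)
  (f_finite : forall y, C y -> f y \is a fin_num)
  (f_C1 : class_C 1 C (fine \o f))
  (M_gt0 : 0 < M) (nu_gt2 : 2 < nu) (nu_le4 : nu <= 4)
  (h_proper : proper_ext h) (h_lsc : lower_semicontinuous h)
  (h_convex : convex_ext h) (h_dom : dom h = C)
  (h_C3 : class_C 3 C (fine \o h))
  (h_gsc : gen_self_concordant M nu C h)
  (h_coercive : 3 < nu -> coercive h)
  (mu_gt0 : 0 < mu) (L_gt0 : 0 < L)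
  (fh_smooth : L_smooth L C f h)
  (x_feasible : feasible C A b x)
  (delta_gt0 : 0 < delta M nu A f h mu x) :
  let d := direction A f h mu x in
  let alpha_bar := 1 / delta M nu A f h mu x in
  let alpha := opt_step M nu L A f h mu x in
  (forall a : R, 0 < a < alpha_bar -> feasible C A b (x + a *: d)) /\
  (forall t : R, 0 < t < alpha_bar ->
     ((eta M nu L A f h mu x t)%:E
        <= potential f h mu x - potential f h mu (x + t *: d))%E) /\
  0 < alpha < alpha_bar /\
  (forall t : R, 0 < t < alpha_bar ->
     eta M nu L A f h mu x t <= eta M nu L A f h mu x alpha).
Proof.
move=> d alpha_bar alpha.
pose dlt := delta M nu A f h mu x; pose l := lambda A f h mu x.
have d0 : d != 0 by apply/eqP => dE; move: delta_gt0; rewrite /delta -/d dE eqxx ltxx.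
have dltE : dlt = M * ((nu - 2) / 2) * l `^ (nu - 2) * norm2 d `^ (3 - nu).
  by rewrite /dlt /delta -/d (negbTE d0).
have dlt0 : 0 < dlt := delta_gt0.
have nu2 : nu - 2 != 0 by rewrite subr_eq0 gt_eqF.
(* Because [nu - 2] is nonzero, [l = 0] would make the power of [l] in [delta] vanish. *)
have l0 : 0 < l.
  rewrite lt_neqAle sqrtr_ge0 andbT eq_sym; apply/eqP => lE.
  by move: dlt0; rewrite dltE lE powR0// mulr0 mul0r ltxx.
(* The default direction is 0, so [d != 0] certifies that [d] is a genuine minimizer. *)
have dirP : is_direction A f h mu x d.
  by move: d0; rewrite /d /direction; case: xgetP => [//|_]; rewrite eqxx.
have [Cx Axb] := x_feasible.
have hNy := proj1 h_proper.
have h_finite y : C y -> h y \is a fin_num.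
  by rewrite -h_dom /dom/= fin_numE hNy/= => hy; rewrite lt_eqF.
have descent := direction_descent dirP l0; rewrite -/(lambda A f h mu x) -/l in descent.
have Lm0 : 0 < L + mu by rewrite addr_gt0.
have tdlt (t : R) : 0 < t < alpha_bar -> [/\ 0 < t, 0 <= t & dlt * t < 1].
  by move=> /andP[t0]; rewrite ltr_pdivlMr// mulrC => ?; split=> //; exact: ltW.
have Cline (t : R) : 0 <= t -> dlt * t < 1 -> C (x + t *: d).
  exact: (gsc_line_dom C h M nu x d l dlt (ltW M_gt0) nu_gt2 h_C3 h_gsc d0
    erefl dltE l0 dlt0 t C_open h_lsc h_dom hNy Cx).
have bound (t : R) : 0 <= t -> dlt * t < 1 ->
    bregman (fine \o h) (x + t *: d) x <= l ^+ 2 / dlt ^+ 2 * omega_sq nu (dlt * t).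
  move=> t0 td; rewrite bregman_line /=.
  have := gsc_line_bound C h M nu x d l dlt (ltW M_gt0) nu_gt2 h_C3 h_gsc d0
    erefl dltE l0 dlt0 t t0 td.
  rewrite -lerBDl opprD addrA; apply => s /andP[s0 st]; apply: Cline => //.
  by rewrite (le_lt_trans _ td)// ler_pM2l.
pose c := dlt / (L + mu).
have c0 : 0 < c by rewrite divr_gt0.
have [/andP[s0 s1] sc] := omega_sq'_invP _ _ nu_gt2 nu_le4 c0.
have alphaE : dlt * alpha = omega_sq'_inv nu c.
  by rewrite /alpha opt_stepE// -/dlt mulVKf// gt_eqF.
have alpha_itv : 0 < alpha < alpha_bar.
  rewrite ltr_pdivlMr// mulrC -/dlt alphaE s1 andbT.
  by rewrite -(pmulr_rgt0 _ dlt0) alphaE.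
split=> [t /tdlt[_ t0 td]|].
  split; first exact: Cline.
  by rewrite /= mulmxDr -scalemxAr (proj1 dirP) scaler0 addr0.
split=> [t /tdlt[t0 t0' td]|].
  have Cy := Cline t t0' td.
  (* The change of the potential is [D_f + mu D_h + t <grad F, d>], at most
     [(L + mu) D_h - t l^2]. *)
  have Hf := fh_smooth _ _ Cx Cy; have Hh := bound t t0' td.
  rewrite etaE ?gt_eqF// -/dlt -/l.
  rewrite (potentialE _ _ _ _ (f_finite _ Cx) (h_finite _ Cx)).
  rewrite (potentialE _ _ _ _ (f_finite _ Cy) (h_finite _ Cy)).
  rewrite -EFinB lee_fin.
  have df : differentiable (fine \o f) x by case: f_C1 => /(_ x Cx).
  have dh : differentiable (fine \o h) x by case: h_C3 => /(_ x Cx).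
  move: descent; rewrite (grad_potential _ C_open)// dotDl dotZl => descent.
  have := ler_wpM2l (ltW Lm0) Hh; rewrite mulrDl.
  move: Hf; rewrite !bregman_line /=.
  set P := dot _ _ in descent *; set Q := dot (grad (fine \o h) x) d in descent *.
  have -> : l ^+ 2 = - (P + mu * Q) by rewrite descent opprK.
  lra.
split=> // t tb; have [t0 _ td] := tdlt t tb.
have [a0 _ ad] := tdlt alpha alpha_itv.
have n2 : nu != 2 by rewrite gt_eqF.
(* The tangent at [dlt * alpha] has slope [c = dlt / (L + mu)]; scaled by [(L + mu) l^2 / dlt^2],
   its linear term becomes [l^2 (t - alpha)], which cancels the linear part of [eta]. *)
have := omega_sq_convex nu _ _ n2 ad td.
rewrite [X in omega_sq' _ X]alphaE sc => H.
have q0 : 0 <= (L + mu) * (l ^+ 2 / dlt ^+ 2).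
  by rewrite mulr_ge0 ?(ltW Lm0)// divr_ge0 ?sqr_ge0.
have := ler_wpM2l q0 H.
rewrite !etaE ?gt_eqF// -/dlt -/l mulrDr.
have -> : (L + mu) * (l ^+ 2 / dlt ^+ 2) * (c * (dlt * t - dlt * alpha)) =
    l ^+ 2 * t - l ^+ 2 * alpha.
  by rewrite /c; field; rewrite !gt_eqF.
lra.
Qed.
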